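(* Assume $F\subseteq\mathbb{R}^{\ell}$ is a nonempty closed convex set, $a\in\mathbb{R}^{\ell}$, $H$ is a proper closed convex subset of $\mathbb{R}^{\ell}$, and $k\in 0^+H\setminus(-0^+H)$. (a) If [$M_{F,a,H,k}=\emptyset$ and $F\cap(a-H+\mathbb{R}k)\neq\emptyset$] or if $M_{F,a,H,k}$ is not bounded, then, for each $b\in\mathbb{R}^{\ell}$ and $k^0\in 0^+H\setminus(-0^+H)$, $M_{F,b,H,k^0}=\emptyset$ or $0^+M_{F,b,H,k^0}\neq\{0\}$. (b) If $M_{F,a,H,k}$ is nonempty and bounded, then, for each $b\in\mathbb{R}^{\ell}$ and $k^0\in 0^+H\setminus(-0^+H)$ with $F\cap(b-H+\mathbb{R}k^0)\neq\emptyset$, $M_{F,b,H,k^0}$ is nonempty and compact.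
   Context: $\ell\ge 1$ is an integer. For $A\subseteq\mathbb{R}^{\ell}$, the recession cone is $0^+A:=\{u\in\mathbb{R}^{\ell}\mid A+\mathbb{R}_+u\subseteq A\}$, where $\mathbb{R}_+=[0,\infty)$. A proper subset of $\mathbb{R}^{\ell}$ is a nonempty subset different from $\mathbb{R}^{\ell}$. For $b\in\mathbb{R}^{\ell}$ and $k^0\in 0^+H\setminus\{0\}$, $(P_{F,b,H,k^0})$ is the problem of minimizing $t$ over all pairs $(y,t)\in F\times\mathbb{R}$ with $y\in b-H+tk^0$ (the feasible solutions). $M_{F,b,H,k^0}$ is the set of its optimal solutions $y$, i.e. of all $y\in F$ for which there is $t\in\mathbb{R}$ such that $(y,t)$ is feasible and $t\le s$ for every feasible $(z,s)$. *)

(* Defs.v *)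
(* R^l is 'rV[R]_l with its sup norm: all norms on R^l have the same closed,
   bounded and compact sets. *)
From mathcomp Require Import all_boot all_order all_algebra.
From mathcomp Require Import all_classical all_reals all_analysis.

Set Implicit Arguments.
Unset Strict Implicit.
Unset Printing Implicit Defensive.

Import Order.TTheory GRing.Theory Num.Theory numFieldNormedType.Exports.

Local Open Scope classical_set_scope.
Local Open Scope ring_scope.

(* In particular the recession cone of the empty set is the whole space. *)
Definition recession_cone (R : realType) (l : nat) (A : set 'rV[R]_l) :
    set 'rV[R]_l :=
  [set u | [set x + r *: u | x in A & r in [set r | 0 <= r]] `<=` A].

Definition feasible (R : realType) (l : nat) (F : set 'rV[R]_l)
    (b : 'rV[R]_l) (H : set 'rV[R]_l) (k : 'rV[R]_l) : set ('rV[R]_l * R) :=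
  [set yt | F yt.1 /\ [set b - h + yt.2 *: k | h in H] yt.1].

(* M_{F,b,H,k}, a set of points y: the optimal value t is projected away. *)
Definition optimal_solutions (R : realType) (l : nat) (F : set 'rV[R]_l)
    (b : 'rV[R]_l) (H : set 'rV[R]_l) (k : 'rV[R]_l) : set 'rV[R]_l :=
  [set y | F y /\ exists t : R, feasible F b H k (y, t) /\
     forall (z : 'rV[R]_l) (s : R), feasible F b H k (z, s) -> t <= s].

(* Main.v *)
(* Whenever M_{F,b,H,k} is nonempty it is a slice F `&` (b - H + t k), so its
   recession cone is C := 0^+F `&` -0^+H, which depends neither on b nor on k.
   A closed convex set with trivial recession cone is compact; hence if C = 0
   all slices are compact, and nested compactness gives first a lower bound on
   the feasible t (otherwise -k would be a recession direction of H) and then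
   an optimal solution. If C contains u <> 0, then u is a recession direction
   of every nonempty M_{F,b,H,k}. *)
Require Import Defs.
From mathcomp Require Import all_boot all_order all_algebra.
From mathcomp Require Import all_classical all_reals all_analysis.
From mathcomp Require Import ring lra.

Import Order.TTheory GRing.Theory Num.Theory numFieldNormedType.Exports.

Local Open Scope classical_set_scope.
Local Open Scope ring_scope.

(** * Nested closed sets, limits along segments, convex combinations *)

Lemma compact_nested_sets {T : topologicalType} {K : set T} {D : nat -> set T} :
  compact K -> (forall n, closed (D n)) ->
  {homo D : m n / (m <= n)%N >-> n `<=` m} ->
  (forall n, (K `&` D n) !=set0) -> exists2 p, K p & forall n, D n p.
Proof.
move=> Kc Dc Ddecr /choice[x KDx].
have xK : (x @ \oo) K by exists 0%N => // n _; exact: (KDx n).1.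
(* A cluster point [p] of the chosen sequence lies in every [D n], since the sequence is eventually
   in that closed set. *)
have [p [Kp px]] := Kc (x @ \oo) _ xK.
exists p => // n; apply: Dc => B pB.
have xD : (x @ \oo) (D n).
  by exists n => // m /= nm; apply: (Ddecr n m) => //; exact: (KDx m).2.
exact: px xD pB.
Qed.

Lemma closed_affine {R : numFieldType} {V : normedModType R} {A : set V}
    (x : V) (r : R) : closed A -> closed [set u | A (x + r *: u)].
Proof.
move=> Ac; apply: (preimage_closed (f := fun u => x + r *: u)) => // u _.
by apply: cvgD; [exact: cvg_cst|apply: cvgZr; exact: cvg_id].
Qed.

(** [x] is the limit of the points [x + harmonic n *: v], where [harmonic n] is 1/(n+1). *)
Lemma closed_segment_end {R : realType} {V : normedModType R} {A : set V}
    (x v : V) : closed A -> (forall p : R, 0 < p <= 1 -> A (x + p *: v)) -> A x.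
Proof.
move=> Ac Ap.
apply: (@closed_cvg _ _ \oo _ (fun n => x + harmonic n *: v) A) => //.
  apply: filterE => n; apply: Ap.
  by rewrite harmonic_gt0 /harmonic /= invf_le1// ler1n.
rewrite -[X in _ --> X]addr0 -[X in _ --> _ + X](scale0r v).
by apply: cvgD; [exact: cvg_cst|apply: cvgZl; exact: cvg_harmonic].
Qed.

Lemma convex_set_comb {R : numDomainType} {V : lmodType R} {A : set V}
    {x y : V} {p : R} : convex_set (A : set (convex_lmodType V)) ->
  0 <= p <= 1 -> A x -> A y -> A (p *: x + (1 - p) *: y).
Proof.
move=> Aconv /andP[p0 p1] Ax Ay.
have /set_mem := Aconv x y (Itv01 p0 p1) (mem_set Ax) (mem_set Ay).
by [].
Qed.

(** * Recession cones and boundedness *)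

Section recession.
Context {R : realType} {l : nat}.
Implicit Types (A F H : set 'rV[R]_l) (b k u x y : 'rV[R]_l).

Lemma recession_coneE A u x (r : R) :
  recession_cone A u -> 0 <= r -> A x -> A (x + r *: u).
Proof. by move=> Au r0 Ax; apply: Au; exists x => //; exists r. Qed.

Lemma convex_halfline {A} u x {r s : R} :
  convex_set (A : set (convex_lmodType 'rV[R]_l)) ->
  A x -> A (x + r *: u) -> 0 <= s <= r -> A (x + s *: u).
Proof.
move=> Aconv Ax Axr /andP[s0 sr].
have [r0|r0] := eqVneq r 0.
  by have -> : s = 0; [apply/le_anti; rewrite -{1}r0 sr|rewrite scale0r addr0].
have rp : 0 < r by rewrite lt0r r0 (le_trans s0).
(* [x + s *: u] divides the segment from [x] to [x + r *: u] in the ratio [s / r]; the degenerate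
   case [r = 0] is already settled. *)
have := convex_set_comb Aconv (p := s / r) _ Axr Ax.
rewrite divr_ge0 ?ler_pdivrMr ?mul1r ?(ltW rp) // => /(_ sr).
congr (A _); apply/rowP => i; rewrite !mxE; field.
exact: r0.
Qed.

(* The points [(1 - p) x + p (x0 + (r / p) u)] tend to [x + r u] as [p] tends
   to [0]. *)
Lemma recession_cone_halfline {A} u x0 : closed A ->
  convex_set (A : set (convex_lmodType 'rV[R]_l)) ->
  (forall r : R, 0 <= r -> A (x0 + r *: u)) -> recession_cone A u.
Proof.
move=> Ac Aconv Au _ [x Ax [r /= r0 <-]].
apply: (closed_segment_end _ (x0 - x) Ac) => p /andP[p0 p1].
have rp : 0 <= r / p by rewrite divr_ge0 ?(ltW p0).
have p01 : 0 <= p <= 1 by rewrite ltW.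
have := convex_set_comb Aconv p01 (Au _ rp) Ax.
congr (A _); apply/rowP => i; rewrite !mxE; field.
exact: lt0r_neq0.
Qed.

Lemma bounded_recession_cone {A} u : A !=set0 -> bounded_set A ->
  recession_cone A u -> u = 0.
Proof.
move=> [x Ax] /pinfty_ex_gt0[M M0 AM] Au; apply/eqP; apply: contrapT => /negP u0.
have up : 0 < `|u| by rewrite normr_gt0.
(* With this [r] the displacement [r *: u] has norm [M + |x| + 1], while both its endpoints in [A]
   allow at most [M + |x|]. *)
pose r := (M + `|x| + 1) / `|u|.
have r0 : 0 <= r by rewrite /r divr_ge0 // !addr_ge0 // ltW.
have := AM _ (recession_coneE _ _ _ _ Au r0 Ax); rewrite /= => xru.
have := ler_normB (x + r *: u) x.
rewrite addrAC subrr add0r normrZ ger0_norm // /r divfK ?gt_eqF // => h.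
by have : M + `|x| + 1 <= M + `|x| by [apply: (le_trans h); rewrite lerD2r]; lra.
Qed.

(** If [A] is unbounded, the unit vectors [u] with [x0 + n *: u] in [A] form nonempty closed sets
    that decrease with [n]. A unit vector common to all of them is a nonzero recession direction. *)
Lemma recession_cone_bounded {A} : closed A ->
  convex_set (A : set (convex_lmodType 'rV[R]_l)) ->
  (forall u, recession_cone A u -> u = 0) -> bounded_set A.
Proof.
move=> Ac Aconv Au.
have [->|/set0P[x0 Ax0]] := eqVneq A set0.
  by exists 0; split => // M _ x [].
apply: contrapT => Anb.
have Abig (M : R) : exists2 x, A x & M < `|x|.
  apply: contrapT => AM; apply: Anb; exists M; split; first exact: num_real.
  move=> N MN x Ax /=; rewrite leNgt; apply/negP => Nx; apply: AM.
  by exists x => //; exact: lt_trans Nx.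
have Sc : compact [set u : 'rV[R]_l | `|u| = 1].
  apply: bounded_closed_compact.
    by exists 1; split; [exact: num_real|move=> M M1 u /= ->; exact: ltW].
  rewrite (_ : mkset _ = (fun u : 'rV[R]_l => `|u|) @^-1` [set 1]) //.
  apply: preimage_closed; last exact: closed_eq.
  by move=> u _; exact: norm_continuous.
have Dc n : closed [set u | A (x0 + n%:R *: u)] by exact: closed_affine.
have [||u u1 Dnu] := compact_nested_sets Sc Dc.
- by move=> m n mn u /= /(convex_halfline u x0 Aconv Ax0); apply; rewrite ler0n ler_nat.
(* The term [|x0|] ensures [|x - x0| > n], so the point at distance [n] from [x0] towards [x] is on
   the segment. *)
- move=> n; have [x Ax nx] := Abig (n%:R + `|x0|).
  have d0 : n%:R < `|x - x0|.
    have := ler_normB x x0; have := lerB_dist x x0; lra.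
  have dp : 0 < `|x - x0| by apply: le_lt_trans d0.
  exists (`|x - x0|^-1 *: (x - x0)); split => /=.
    by rewrite normrZ normfV normr_id mulVf // gt_eqF.
  apply: (convex_halfline _ _ (r := `|x - x0|) Aconv) => //; last by rewrite ler0n ltW.
  by rewrite scalerA mulfV ?gt_eqF // scale1r addrC subrK.
have : u = 0.
  apply: Au; apply: (recession_cone_halfline _ x0) => // r r0.
  (* Integer multiples of [u] suffice: [r] lies below the next integer, and convexity fills the
     gap. *)
  apply: (convex_halfline _ _ Aconv Ax0 (Dnu (Num.truncn r).+1)).
  by rewrite r0 /= ltW // truncnS_gt.
by move=> u0; move: u1; rewrite u0 /= normr0 => /eqP; rewrite eq_sym oner_eq0.
Qed.

(** * Slices of the feasible set at a fixed level *)

Definition feasible_slice F b H k (t : R) : set 'rV[R]_l :=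
  F `&` [set y | H (b - y + t *: k)].

(** Solving [y = b - h + t *: k] for [h] turns the constraint into an affine preimage of [H]. *)
Lemma feasibleE F b H k y t :
  feasible F b H k (y, t) <-> feasible_slice F b H k t y.
Proof.
split=> -[Fy Hy]; split => //=.
  by case: Hy => h Hh /= <-; rewrite [X in H X](_ : _ = h) //; apply/rowP=> i; rewrite !mxE; ring.
by exists (b - y + t *: k) => //=; apply/rowP=> i; rewrite !mxE; ring.
Qed.

Lemma feasible_some F b H k :
  F `&` [set b - h + t *: k | h in H & t in [set: R]] <> set0 ->
  exists t, feasible_slice F b H k t !=set0.
Proof.
move=> /eqP/set0P[y [Fy [h Hh [t _ yE]]]]; exists t, y.
by apply/feasibleE; split => //; exists h.
Qed.

(** Any two optimal solutions have the same value by antisymmetry, so one level serves them all. *)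
Lemma optimal_solutionsE F b H k : optimal_solutions F b H k !=set0 ->
  exists t, optimal_solutions F b H k = feasible_slice F b H k t.
Proof.
move=> [y [_ [t [fyt tmin]]]]; exists t; apply/seteqP; split => z.
  move=> [_ [s [fzs smin]]]; apply/feasibleE.
  by have -> : t = s by apply/le_anti; rewrite (tmin _ _ fzs) (smin _ _ fyt).
move=> fz; split; first exact: fz.1.
by exists t; split => //; exact/feasibleE.
Qed.

Section slices.
Context {F H : set 'rV[R]_l}.
Hypotheses (Fc : closed F) (Hc : closed H).
Hypothesis Fconv : convex_set (F : set (convex_lmodType 'rV[R]_l)).
Hypothesis Hconv : convex_set (H : set (convex_lmodType 'rV[R]_l)).

Lemma feasible_slice_closed b k t : closed (feasible_slice F b H k t).
Proof.
apply: closedI => //.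
rewrite (_ : mkset _ = [set u | H ((b + t *: k) + (-1) *: u)]).
  exact: closed_affine.
by apply/funext => u /=; congr (H _); rewrite scaleN1r addrAC.
Qed.

Lemma feasible_slice_convex b k t : convex_set
  (feasible_slice F b H k t : set (convex_lmodType 'rV[R]_l)).
Proof.
move=> x y p /set_mem[/= Fx Hx] /set_mem[/= Fy Hy]; apply/mem_set.
have p01 : 0 <= p%:num <= 1 by apply/andP; split.
split; first exact: (convex_set_comb Fconv p01 Fx Fy).
have := convex_set_comb Hconv p01 Hx Hy.
by congr (H _); apply/rowP => i; rewrite !mxE /= /unstable.onem; ring.
Qed.

(** Moving [y] along [u] moves [b - y + t *: k] along [- u]. A half-line from one point of the slice
    decides for both [F] and [H], as these are closed and convex. *)
Lemma recession_cone_feasible_slice b k t u :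
  feasible_slice F b H k t !=set0 ->
  recession_cone (feasible_slice F b H k t) u <->
  recession_cone F u /\ recession_cone H (- u).
Proof.
move=> [x [Fx Hx]]; split=> [Su|[Fu Hu] _ [y [Fy Hy] [r r0 <-]]].
  have xr (r : R) (r0 : 0 <= r) := recession_coneE _ _ _ r Su r0 (conj Fx Hx).
  split; first by apply: (recession_cone_halfline _ x) => // r /xr[].
  apply: (recession_cone_halfline _ (b - x + t *: k)) => // r /xr[_].
  by congr (H _); apply/rowP => i; rewrite !mxE; ring.
split; first exact: recession_coneE.
have := recession_coneE _ _ _ _ Hu r0 Hy.
by congr (H _); apply/rowP => i; rewrite !mxE; ring.
Qed.

Lemma feasible_slice_compact b k t :
  (forall u, recession_cone F u -> recession_cone H (- u) -> u = 0) ->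
  compact (feasible_slice F b H k t).
Proof.
move=> FH0; have [->|/set0P S0] := eqVneq (feasible_slice F b H k t) set0.
  exact: compact0.
apply: bounded_closed_compact; last exact: feasible_slice_closed.
apply: recession_cone_bounded;
  [exact: feasible_slice_closed|exact: feasible_slice_convex|].
by move=> u /(recession_cone_feasible_slice _ _ _ _ S0)[]; exact: FH0.
Qed.

Lemma optimal_solutions_nonempty b k :
  (forall u, recession_cone F u -> recession_cone H (- u) -> u = 0) ->
  recession_cone H k -> ~ recession_cone H (- k) ->
  (exists t, feasible_slice F b H k t !=set0) ->
  optimal_solutions F b H k !=set0.
Proof.
move=> FH0 Hk HNk [t0 [y0 Sy0]].
(* Raising the level adds a nonnegative multiple of the recession direction [k] to a point of
   [H]. *)
have Smono s t : s <= t -> feasible_slice F b H k s `<=` feasible_slice F b H k t.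
  move=> st y [Fy Hy]; split => //=.
  have := recession_coneE _ _ _ (t - s) Hk _ Hy; rewrite subr_ge0 => /(_ st).
  by congr (H _); apply/rowP => i; rewrite !mxE; ring.
pose T := [set t | feasible_slice F b H k t !=set0].
have Tinf : has_inf T.
  split; first by exists t0, y0.
  apply: contrapT => Tnlb.
  have Sne s : feasible_slice F b H k s !=set0.
    apply: contrapT => Ss; apply: Tnlb; exists s => t [y Sty].
    by rewrite leNgt; apply/negP => /ltW /Smono ts; apply: Ss; exists y; exact: ts.
  (* A point [y] feasible at all levels [t0 - n] would give a half-line in [H] with direction
     [- k]. *)
  have [||y _ Sy] := compact_nested_sets (feasible_slice_compact b k t0 FH0)
    (fun n => feasible_slice_closed b k (t0 - n%:R)).
  - by move=> m n mn; apply: Smono; rewrite lerB // ler_nat.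
  - move=> n; have [y Sy] := Sne (t0 - n%:R); exists y; split => //.
    by apply: Smono Sy; rewrite gerBl.
  apply: HNk; apply: (recession_cone_halfline _ (b - y + t0 *: k)) => // r r0.
  have /Smono : t0 - (Num.truncn r).+1%:R <= t0 - r.
    by rewrite lerB // ltW // truncnS_gt.
  move=> /(_ _ (Sy _))[_] /=.
  by congr (H _); apply/rowP => i; rewrite !mxE; ring.
have Sgt t : inf T < t -> feasible_slice F b H k t !=set0.
  move=> /[dup] tT; rewrite -subr_gt0 => /inf_adherent /(_ Tinf)[s [y Sy]].
  by rewrite addrC subrK => /ltW /Smono st; exists y; exact: st.
(* Levels slightly above [inf T] have nonempty slices, all inside the compact slice at [inf T + 1];
   a common point is the candidate optimum. *)
have [||y _ Sy] := compact_nested_sets (feasible_slice_compact b k (inf T + 1) FH0)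
    (fun n => feasible_slice_closed b k (inf T + harmonic n)).
- move=> m n mn; apply: Smono; rewrite lerD2l /harmonic /=.
  by rewrite lef_pV2 ?posrE // ler_nat.
- move=> n; have [|y Sy] := Sgt (inf T + harmonic n).
    by rewrite ltrDl harmonic_gt0.
  exists y; split => //; apply: Smono Sy.
  by rewrite lerD2l /harmonic /= invf_le1 // ler1n.
have Sinf : feasible_slice F b H k (inf T) y.
  split; first exact: (Sy 0%N).1.
  apply: (closed_segment_end _ k Hc) => p /andP[p0 _].
  (* The index is chosen so that 1/(n+1) is at most [p]: the integer part of [p^-1] plus one exceeds
     [p^-1]. *)
  have /Smono : inf T + harmonic (Num.truncn p^-1) <= inf T + p.
    rewrite lerD2l /harmonic /= -[leRHS]invrK.
    by rewrite lef_pV2 ?posrE ?invr_gt0 // ltW // truncnS_gt.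
  move=> /(_ _ (Sy _))[_] /=.
  by congr (H _); apply/rowP => i; rewrite !mxE; ring.
exists y; split; first exact: Sinf.1.
exists (inf T); split; first exact/feasibleE.
by move=> z s /feasibleE Sz; apply: ge_inf; [exact: Tinf.2|exists z].
Qed.

End slices.
End recession.

Theorem proposition17 (R : realType) (l : nat) (hl : (1 <= l)%N)
    (F H : set 'rV[R]_l) (a k : 'rV[R]_l)
    (F_nonempty : F !=set0) (F_closed : closed F)
    (F_convex : convex_set (F : set (convex_lmodType 'rV[R]_l)))
    (H_nonempty : H !=set0) (H_neqT : H <> [set: 'rV[R]_l])
    (H_closed : closed H)
    (H_convex : convex_set (H : set (convex_lmodType 'rV[R]_l)))
    (hk : (recession_cone H `\` [set - u | u in recession_cone H]) k) :
  ((optimal_solutions F a H k = set0 /\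
      F `&` [set a - h + t *: k | h in H & t in [set: R]] <> set0) \/
     ~ bounded_set (optimal_solutions F a H k) ->
   forall b k0 : 'rV[R]_l,
     (recession_cone H `\` [set - u | u in recession_cone H]) k0 ->
     optimal_solutions F b H k0 = set0 \/
     recession_cone (optimal_solutions F b H k0) <> [set 0]) /\
  (optimal_solutions F a H k !=set0 ->
   bounded_set (optimal_solutions F a H k) ->
   forall b k0 : 'rV[R]_l,
     (recession_cone H `\` [set - u | u in recession_cone H]) k0 ->
     F `&` [set b - h + t *: k0 | h in H & t in [set: R]] <> set0 ->
     optimal_solutions F b H k0 !=set0 /\
     compact (optimal_solutions F b H k0)).
Proof.
have rayP (k' : 'rV[R]_l) :
    (recession_cone H `\` [set - u | u in recession_cone H]) k' ->
    recession_cone H k' /\ ~ recession_cone H (- k').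
  by move=> [Hk' HNk']; split => // Hk''; apply: HNk'; exists (- k'); rewrite ?opprK.
have [Hk HNk] := rayP _ hk.
split=> [Ma b k0 _|Ma0 Mabnd b k0 /rayP[Hk0 HNk0] /feasible_some Fb].
  (* Without such a [u], the problem for [a] and [k] would have an optimal solution once feasible,
     and its solution set would be bounded: both alternatives fail. *)
  have [u [Fu Hu u0]] :
      exists u, [/\ recession_cone F u, recession_cone H (- u) & u <> 0].
    apply: contrapT => FHn0.
    have FH0 u : recession_cone F u -> recession_cone H (- u) -> u = 0.
      by move=> Fu Hu; apply: contrapT => u0; apply: FHn0; exists u.
    case: Ma => [[Ma0 /feasible_some Fa]|Ma].
      have := optimal_solutions_nonempty F_closed H_closed F_convex H_convex
        _ _ FH0 Hk HNk Fa.
      by rewrite Ma0 => -[].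
    apply: Ma; have [->|/set0P Ma0] := eqVneq (optimal_solutions F a H k) set0.
      by exists 0; split => // M _ x [].
    have [t ->] := optimal_solutionsE _ _ _ _ Ma0.
    by apply: compact_bounded; exact: feasible_slice_compact.
  have [->|/set0P Mb0] := eqVneq (optimal_solutions F b H k0) set0; [by left|right].
  have [t Mb] := optimal_solutionsE _ _ _ _ Mb0; rewrite Mb in Mb0 *.
  move=> S0; apply: u0; rewrite -[u = 0]/([set 0] u) -S0.
  exact/recession_cone_feasible_slice.
have [t Mt] := optimal_solutionsE _ _ _ _ Ma0; rewrite Mt in Ma0 Mabnd.
(* The common cone is read off from the nonempty bounded slice for [a] and [k], then applied to [b]
   and [k0]. *)
have FH0 u : recession_cone F u -> recession_cone H (- u) -> u = 0.
  move=> Fu Hu; apply: (bounded_recession_cone _ Ma0 Mabnd).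
  exact/recession_cone_feasible_slice.
have Mb0 := optimal_solutions_nonempty F_closed H_closed F_convex H_convex
  _ _ FH0 Hk0 HNk0 Fb.
split => //; have [s ->] := optimal_solutionsE _ _ _ _ Mb0.
exact: feasible_slice_compact.
Qed.
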